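(* Let $s\in\{0,\tfrac12\}$ and let $S(s)$ be the centerless super-Virasoro algebra over $\mathbb{C}$. If $f:S(s)\to S(s)$ is a linear super commuting map, i.e. a $\mathbb{C}$-linear map with $[f(x),x]=0$ for all $x\in S(s)$, then there exists $\lambda\in\mathbb{C}$ such that $f(x)=\lambda x$ for all $x\in S(s)$.
   Context: All vector spaces are over $\mathbb{C}$. For $s\in\{0,\tfrac12\}$, the centerless super-Virasoro algebra $S(s)=S_{\bar0}(s)\oplus S_{\bar1}(s)$ is the Lie superalgebra whose even part has basis $\{L_m : m\in\mathbb{Z}\}$ and whose odd part has basis $\{G_k : k\in s+\mathbb{Z}\}$, with brackets $[L_m,L_n]=(n-m)L_{m+n}$, $[L_m,G_k]=(k-\tfrac m2)G_{m+k}$, $[G_k,G_l]=2L_{k+l}$ for all $m,n\in\mathbb{Z}$, $k,l\in s+\mathbb{Z}$ (the remaining brackets being determined by skew-supersymmetry $[x,y]=-(-1)^{|x||y|}[y,x]$, where $|x|\in\mathbb{Z}_2$ is the degree of a homogeneous element $x$). For a Lie superalgebra $L$, a linear super commuting map of $L$ is a linear map $f:L\to L$ such that $[f(x),x]=0$ for all $x\in L$. *)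

(* Defs.v *)
From HB Require Import structures.
From mathcomp Require Import all_boot all_order all_algebra.
From mathcomp Require Import finmap complex reals ring.
From mathcomp.multinomials Require Import monalg.

Set Implicit Arguments.
Unset Strict Implicit.
Unset Printing Implicit Defensive.

Import Order.TTheory GRing.Theory Num.Theory.
Local Open Scope ring_scope.

Section LieSuperalgebra.
Context (K : fieldType) (V : lmodType K).
Implicit Types (br : V -> V -> V) (hom : bool -> V -> Prop).

(* [hom p x] reads "x is homogeneous of degree p"; the elements of Z_2 are the
   booleans, [false] being the even degree and [(+)] the addition. *)
Record is_lie_superalgebra hom br : Prop := IsLieSuperalgebra {
  lsa_linearl : forall y, linear (br^~ y);
  lsa_linearr : forall x, linear (br x);
  lsa_hom0 : forall p, hom p 0;
  lsa_homP : forall p a x y, hom p x -> hom p y -> hom p (a *: x + y);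
  lsa_decomp : forall x, exists x0 x1,
    [/\ hom false x0, hom true x1 & x = x0 + x1];
  lsa_direct : forall x, hom false x -> hom true x -> x = 0;
  lsa_hom_br : forall p q x y, hom p x -> hom q y -> hom (p (+) q) (br x y);
  lsa_skew : forall p q x y, hom p x -> hom q y ->
    br x y = - ((-1) ^+ (p && q) *: br y x);
  lsa_jacobi : forall p q r x y z, hom p x -> hom q y -> hom r z ->
    br x (br y z) = br (br x y) z + (-1) ^+ (p && q) *: br y (br x z)
}.

(* All elements are tested, not only the homogeneous ones. *)
Definition super_commuting br (f : {linear V -> V}) : Prop :=
  forall x, br (f x) x = 0.

End LieSuperalgebra.

(* The coset s + Z, inside the rationals. *)
Record coset (s : rat) := Coset {
  coset_val : rat;
  cosetP : coset_val - s \is a Num.int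
}.
HB.instance Definition _ (s : rat) := [isSub for @coset_val s].
HB.instance Definition _ (s : rat) := [Choice of coset s by <:].

Lemma coset_addP (s : rat) (m : int) (k : coset s) :
  m%:~R + val k - s \is a Num.int.
Proof. by rewrite -addrA rpredD ?intr_int ?cosetP. Qed.

Definition coset_add (s : rat) (m : int) (k : coset s) : coset s :=
  Coset (coset_addP m k).

(* For k, l in s + Z with s = 0 or s = 1/2, the rational k + l is an integer
   (see [coset_sumE]), which [Num.floor] only converts to the type [int]. *)
Definition coset_sum (s : rat) (k l : coset s) : int :=
  Num.floor (val k + val l).

Lemma coset_sumE (s : rat) (k l : coset s) : s = 0 \/ s = 2^-1 ->
  (coset_sum k l)%:~R = val k + val l.
Proof.
move=> hs; apply/eqP; rewrite -intrEfloor.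
have -> : val k + val l = (val k - s) + (val l - s) + (s + s) by ring.
apply: rpredD; first by apply: rpredD; apply: cosetP.
by case: hs => ->; rewrite ?addr0 ?rpred0.
Qed.

(* The labels of the basis {L_m} u {G_k}. *)
Definition svir_basis (s : rat) : choiceType := (int + coset s)%type.

Section SuperVirasoro.
Context (K : numFieldType) (s : rat).

(* Finitely supported functions from the labels to K, i.e. finite linear
   combinations of the L_m and the G_k. *)
Definition svir : lmodType K := {malg K[svir_basis s]}.

Definition svL (m : int) : svir := << (inl m : svir_basis s) >>.
Definition svG (k : coset s) : svir := << (inr k : svir_basis s) >>.

Definition svir_br_basis (a b : svir_basis s) : svir :=
  match a, b with
  | inl m, inl n => (n - m)%:~R *: svL (m + n)
  | inl m, inr k => ratr (val k - m%:~R / 2) *: svG (coset_add m k)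
  | inr k, inl m => - (ratr (val k - m%:~R / 2) *: svG (coset_add m k))
  | inr k, inr l => 2 *: svL (coset_sum k l)
  end.

Definition svir_br (x y : svir) : svir :=
  \sum_(a <- msupp x) \sum_(b <- msupp y)
    (x@_a * y@_b) *: svir_br_basis a b.

Definition svir_parity (a : svir_basis s) : bool :=
  if a is inr _ then true else false.

Definition svir_hom (p : bool) (x : svir) : Prop :=
  forall a, a \in msupp x -> svir_parity a = p.


Lemma svir_brEw (A B : {fset svir_basis s}) x y :
  (msupp x `<=` A)%fset -> (msupp y `<=` B)%fset ->
  svir_br x y =
    \sum_(a <- A) \sum_(b <- B) (x@_a * y@_b) *: svir_br_basis a b.
Proof.
move=> hA hB; rewrite /svir_br.
transitivity (\sum_(a <- msupp x) \sum_(b <- B)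
    (x@_a * y@_b) *: svir_br_basis a b).
  apply: eq_bigr => a _; apply: big_fset_incl => // b _ /mcoeff_outdom ->.
  by rewrite mulr0 scale0r.
apply: big_fset_incl => // a _ /mcoeff_outdom ->.
by rewrite big1 // => b _; rewrite mul0r scale0r.
Qed.

Lemma svir_br_linearl y : linear (svir_br^~ y).
Proof.
move=> c x x'; set A := (msupp (c *: x + x') `|` (msupp x `|` msupp x'))%fset.
have h1 : (msupp (c *: x + x') `<=` A)%fset by apply: fsubsetUl.
have h2 : (msupp x `<=` A)%fset.
  by apply: fsubset_trans (fsubsetUr _ _); apply: fsubsetUl.
have h3 : (msupp x' `<=` A)%fset.
  by apply: fsubset_trans (fsubsetUr _ _); apply: fsubsetUr.
rewrite (svir_brEw h1 (fsubset_refl _)) (svir_brEw h2 (fsubset_refl _)).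
rewrite (svir_brEw h3 (fsubset_refl _)) scaler_sumr -big_split /=.
apply: eq_bigr => a _; rewrite scaler_sumr -big_split /=.
apply: eq_bigr => b _.
by rewrite mcoeffD mcoeffZ mulrDl scalerDl scalerA mulrA.
Qed.

Lemma svir_br_linearr x : linear (svir_br x).
Proof.
move=> c y y'; set B := (msupp (c *: y + y') `|` (msupp y `|` msupp y'))%fset.
have h1 : (msupp (c *: y + y') `<=` B)%fset by apply: fsubsetUl.
have h2 : (msupp y `<=` B)%fset.
  by apply: fsubset_trans (fsubsetUr _ _); apply: fsubsetUl.
have h3 : (msupp y' `<=` B)%fset.
  by apply: fsubset_trans (fsubsetUr _ _); apply: fsubsetUr.
rewrite (svir_brEw (fsubset_refl _) h1) (svir_brEw (fsubset_refl _) h2).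
rewrite (svir_brEw (fsubset_refl _) h3) scaler_sumr -big_split /=.
apply: eq_bigr => a _; rewrite scaler_sumr -big_split /=.
apply: eq_bigr => b _.
by rewrite mcoeffD mcoeffZ mulrDr scalerDl scalerA mulrCA.
Qed.

HB.instance Definition _ x :=
  GRing.isLinear.Build K svir svir *:%R (svir_br x) (svir_br_linearr x).

Lemma svir_brZl c x y : svir_br (c *: x) y = c *: svir_br x y.
Proof.
have h0 : svir_br 0 y = 0 by rewrite /svir_br msupp0 big_seq_fset0.
by have := svir_br_linearl y c x 0; rewrite !addr0 h0 addr0.
Qed.

Lemma svir_brE (a b : svir_basis s) :
  svir_br (<< a >> : svir) (<< b >> : svir) = svir_br_basis a b.
Proof.
rewrite (svir_brEw (msuppU_le (k:=a) (x:=1)) (msuppU_le (k:=b) (x:=1))).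
by rewrite !big_seq_fset1 !mcoeffUU mulr1 scale1r.
Qed.

Lemma svir_br_LL m n : svir_br (svL m) (svL n) = (n - m)%:~R *: svL (m + n).
Proof. exact: svir_brE. Qed.

Lemma svir_br_LG m k :
  svir_br (svL m) (svG k) = ratr (val k - m%:~R / 2) *: svG (coset_add m k).
Proof. exact: svir_brE. Qed.

Lemma svir_br_GL m k :
  svir_br (svG k) (svL m) = - (ratr (val k - m%:~R / 2) *: svG (coset_add m k)).
Proof. exact: svir_brE. Qed.

Lemma svir_br_GG k l : svir_br (svG k) (svG l) = 2 *: svL (coset_sum k l).
Proof. exact: svir_brE. Qed.

Lemma svir_hom0 p : svir_hom p 0.
Proof. by move=> a; rewrite msupp0. Qed.

Lemma svir_homP p c x y :
  svir_hom p x -> svir_hom p y -> svir_hom p (c *: x + y).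
Proof.
move=> hx hy a /(fsubsetP (msuppD_le _ _)); rewrite in_fsetU => /orP[|/hy//].
by move=> /(fsubsetP (msuppZ_le _ _)) /hx.
Qed.

Lemma svir_homN p x : svir_hom p x -> svir_hom p (- x).
Proof. by move=> hx a; rewrite msuppN => /hx. Qed.

Lemma svir_homU (a : svir_basis s) : svir_hom (svir_parity a) (<< a >> : svir).
Proof. by move=> b /(fsubsetP msuppU_le); rewrite in_fset1 => /eqP ->. Qed.

Lemma svir_hom_ind p (P : svir -> Prop) :
  P 0 -> (forall c x y, P x -> P y -> P (c *: x + y)) ->
  (forall a : svir_basis s, svir_parity a = p -> P << a >>) ->
  forall x, svir_hom p x -> P x.
Proof.
move=> P0 PD PU x hx; rewrite [x]monalgE big_seq.
apply: (big_rec P) => // a y ax Py.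
have -> : << x@_a *g a >> = x@_a *: (<< a >> : svir).
  by apply/malgP => b; rewrite mcoeffZ !mcoeffU mulrnAr mulr1.
exact: PD (PU _ (hx _ ax)) Py.
Qed.

Lemma svir_decomp x : exists x0 x1,
  [/\ svir_hom false x0, svir_hom true x1 & x = x0 + x1].
Proof.
rewrite [x]monalgE; elim/big_rec: _ => [|a y _ [y0 [y1 [h0 h1 ->]]]].
  by exists 0, 0; split; [exact: svir_hom0|exact: svir_hom0|rewrite addr0].
have -> : << x@_a *g a >> = x@_a *: (<< a >> : svir).
  by apply/malgP => b; rewrite mcoeffZ !mcoeffU mulrnAr mulr1.
have ha := @svir_homU a.
case: (svir_parity a) ha => ha.
  exists y0, (x@_a *: (<< a >> : svir) + y1); split=> //; last by rewrite addrCA.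
  exact: svir_homP.
exists (x@_a *: (<< a >> : svir) + y0), y1; split=> //; last by rewrite addrA.
exact: svir_homP.
Qed.

Lemma svir_direct x : svir_hom false x -> svir_hom true x -> x = 0.
Proof.
move=> h0 h1; apply/malgP => a; rewrite mcoeff0; apply: mcoeff_outdom.
by apply/negP => ax; have := h0 a ax; rewrite (h1 a ax).
Qed.

Lemma svir_hom_br_basis (a b : svir_basis s) :
  svir_hom (svir_parity a (+) svir_parity b) (svir_br_basis a b).
Proof.
have hZ c d : svir_hom (svir_parity d) (c *: (<< d >> : svir)).
  by rewrite -[_ *: _]addr0; apply: svir_homP; [exact: svir_homU | exact: svir_hom0].
case: a b => [m|k] [n|l] /=; [exact: hZ | exact: hZ | | exact: hZ].
by apply: svir_homN; apply: hZ.
Qed.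

Lemma svir_hom_br p q x y :
  svir_hom p x -> svir_hom q y -> svir_hom (p (+) q) (svir_br x y).
Proof.
move=> hx hy; rewrite /svir_br !big_seq; apply: big_ind => [|u v hu hv|a ax].
- exact: svir_hom0.
- by rewrite -[u]scale1r; apply: svir_homP.
rewrite big_seq; apply: big_ind => [|u v hu hv|b bx].
- exact: svir_hom0.
- by rewrite -[u]scale1r; apply: svir_homP.
rewrite -[_ *: _]addr0; apply: svir_homP (svir_hom0 _).
by rewrite -(hx _ ax) -(hy _ bx); apply: svir_hom_br_basis.
Qed.

Lemma svir_skew_basis (a b : svir_basis s) :
  svir_br_basis a b =
  - ((-1) ^+ (svir_parity a && svir_parity b) *: svir_br_basis b a).
Proof.
case: a b => [m|k] [n|l]; rewrite /svir_br_basis /svir_parity.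
- by rewrite expr0 scale1r -scaleNr -rmorphN opprB addrC [(n + m)%R]addrC.
- by rewrite expr0 scale1r opprK.
- by rewrite expr0 scale1r.
- by rewrite expr1 scaleN1r opprK /coset_sum addrC.
Qed.

Lemma svir_skew p q x y : svir_hom p x -> svir_hom q y ->
  svir_br x y = - ((-1) ^+ (p && q) *: svir_br y x).
Proof.
move=> hx hy; rewrite /svir_br [in RHS]exchange_big /= scaler_sumr -sumrN.
rewrite !big_seq; apply: eq_bigr => a ax; rewrite scaler_sumr -sumrN.
rewrite !big_seq; apply: eq_bigr => b bx.
rewrite svir_skew_basis (hx _ ax) (hy _ bx) scalerN !scalerA.
by rewrite mulrC [x@_a * _]mulrC.
Qed.

Context (hs : s = 0 \/ s = 2^-1).

Lemma svir_jacobi_basis (a b c : svir_basis s) :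
  let x : svir := << a >> in let y : svir := << b >> in
  let z : svir := << c >> in
  svir_br x (svir_br y z) = svir_br (svir_br x y) z
    + (-1) ^+ (svir_parity a && svir_parity b) *: svir_br y (svir_br x z).
Proof.
have eG k l : val k = val l -> svG k = svG l by move/val_inj->.
have eL m n : m%:~R = n%:~R :> rat -> svL m = svL n by move/intr_inj->.
have valD m k : val (coset_add m k) = m%:~R + val k by [].
have sumE k l := coset_sumE k l hs.
have LL m n : svir_br (svL m) (svL n) = ratr (n%:~R - m%:~R) *: svL (m + n).
  by rewrite svir_br_LL -[_%:~R]ratr_int rmorphB.
have LG := svir_br_LG.
have GL m k : svir_br (svG k) (svL m) =
    ratr (m%:~R / 2 - val k) *: svG (coset_add m k).
  by rewrite svir_br_GL -scaleNr -rmorphN opprB.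
have GG k l : svir_br (svG k) (svG l) = ratr 2 *: svL (coset_sum k l).
  by rewrite svir_br_GG ratr_nat.
have Zr d x y : svir_br x (d *: y) = d *: svir_br x y by rewrite linearZ.
have fin (c1 c2 c3 : rat) (v1 v2 v3 : svir) :
    v2 = v1 -> v3 = v1 -> c1 = c2 + c3 ->
    ratr c1 *: v1 = ratr c2 *: v2 + ratr c3 *: v3.
  by move=> -> -> ->; rewrite rmorphD scalerDl.
have finN (c1 c2 c3 : rat) (v1 v2 v3 : svir) :
    v2 = v1 -> v3 = v1 -> c1 = c2 - c3 ->
    ratr c1 *: v1 = ratr c2 *: v2 - ratr c3 *: v3.
  by move=> -> -> ->; rewrite rmorphB scalerBl.
pose B (d : svir_basis s) := match d with inl m => svL m | inr k => svG k end.
have BE d : << d >> = B d by case: d.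
rewrite !BE.
rewrite /B; move: svir_br svL svG svir_brZl eG eL LL LG GL GG Zr {BE B}.
move=> br L G Zl eG eL LL LG GL GG Zr.
case: a b c => [m|k] [n|l] [o|j]; rewrite /svir_parity.
all: rewrite ?expr0 ?expr1 ?scale1r ?scaleN1r.
all: rewrite !(LL, LG, GL, GG) !(Zr, Zl) !(LL, LG, GL, GG) !scalerA.
all: rewrite -!rmorphM; (apply: fin || apply: finN).
all: try apply: eL; try apply: eG.
all: rewrite ?(valD, rmorphD, rmorphB, sumE) /= ?sumE /=.
all: by [|field].
Qed.

Lemma svir_jacobi p q r x y z :
  svir_hom p x -> svir_hom q y -> svir_hom r z ->
  svir_br x (svir_br y z) = svir_br (svir_br x y) z
    + (-1) ^+ (p && q) *: svir_br y (svir_br x z).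
Proof.
have brDr u d v w : svir_br u (d *: v + w) = d *: svir_br u v + svir_br u w.
  exact: svir_br_linearr.
have brDl u d v w : svir_br (d *: v + w) u = d *: svir_br v u + svir_br w u.
  exact: svir_br_linearl.
have br0l w : svir_br 0 w = 0 by rewrite /svir_br msupp0 big_seq_fset0.
have br0r w : svir_br w 0 = 0 by rewrite linear0.
have lin e d (u u' v v' w w' : svir) : u = v + e *: w -> u' = v' + e *: w' ->
    d *: u + u' = (d *: v + v') + e *: (d *: w + w').
  by move=> -> ->; rewrite !scalerDr !scalerA addrACA [d * e]mulrC.
have := svir_jacobi_basis.
move: svir_br brDr brDl br0l br0r => br brDr brDl br0l br0r jac.
move=> hx hy; move: z; apply: svir_hom_ind => [|d z z' IH IH'|c _].
- by rewrite !br0r scaler0 addr0.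
- by rewrite !brDr; apply: lin.
move: y hy; apply: svir_hom_ind => [|d y y' IH IH'|b hb].
- by rewrite !(br0l, br0r) scaler0 addr0.
- by rewrite brDl !brDr !brDl; apply: lin.
move: x hx; apply: svir_hom_ind => [|d x x' IH IH'|a ha].
- by rewrite !(br0l, br0r) scaler0 addr0.
- by rewrite !brDl brDr; apply: lin.
by rewrite -ha -hb; apply: jac.
Qed.

Theorem svir_lie_superalgebra : is_lie_superalgebra svir_hom svir_br.
Proof.
split.
- exact: svir_br_linearl.
- exact: svir_br_linearr.
- exact: svir_hom0.
- exact: svir_homP.
- exact: svir_decomp.
- exact: svir_direct.
- exact: svir_hom_br.
- exact: svir_skew.
- exact: svir_jacobi.
Qed.

End SuperVirasoro.

(* Main.v *)
(** Already the odd generators determine [f]: the only L-component of [f G_k]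
    that [[f G_k, G_k] = 0] allows is the one on L_(2k), and polarizing
    against G_l with l <> k kills it, so [f] vanishes on the odd part. Then
    [f L_m] centralizes every G_k, which forces [f L_m = 0]. Hence [f = 0]; no
    nonzero scalar is super commuting, because [[G_k, G_k] = 2 L_(2k)]. *)
Require Import Defs.
From mathcomp Require Import all_boot all_order all_algebra complex reals.
From mathcomp Require Import finmap ring.
From mathcomp.multinomials Require Import monalg.
Import GRing.Theory Num.Theory.
Local Open Scope ring_scope.

Section SuperVirasoroCommuting.
Context (K : numFieldType) (s : rat).
Implicit Types (x : svir K s) (k l : coset s).

(** Reads off single coefficients of [x] from a bracket, when only the label [a] can reach [c]
    against [b]. *)
Lemma svir_br_coeff x (a b c : svir_basis s) :
  (forall a', a' != a -> (svir_br_basis K a' b)@_c = 0) ->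
  (svir_br x (<< b >> : svir K s))@_c = x@_a * (svir_br_basis K a b)@_c.
Proof.
move=> h.
(* The label [a] may lie outside the support of [x], so it is adjoined before its term is split
   off. *)
rewrite (@svir_brEw _ _ (a |` msupp x)%fset [fset b]%fset); first last.
- exact: msuppU_le.
- exact: fsubsetUr.
rewrite raddf_sum (bigD1_seq a) ?fset_uniq ?fset1U1 //= [X in _ + X]big1 => [|a' ha'].
  by rewrite big_seq_fset1 mcoeffUU mulr1 mcoeffZ addr0.
by rewrite big_seq_fset1 mcoeffZ h ?mulr0.
Qed.

Lemma svir_br_G_coeffG x (n : int) k :
  (svir_br x (svG K k))@_(inr (coset_add n k) : svir_basis s)
  = x@_(inl n : svir_basis s) * ratr (val k - n%:~R / 2).
Proof.
rewrite (@svir_br_coeff _ (inl n)) => [|[m|l] hm]; rewrite /= mcoeffZ.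
- by rewrite mcoeffUU mulr1.
- rewrite mcoeffU; case: eqP => [[]|]; rewrite ?mulr0 // => /addIr/intr_inj e.
  by rewrite e eqxx in hm.
- by rewrite mcoeffU mulr0.
Qed.

Context (hs : s = 0 \/ s = 2^-1).

Lemma svir_br_G_coeffL x k l :
  (svir_br x (svG K k))@_(inl (coset_sum l k) : svir_basis s)
  = x@_(inr l : svir_basis s) * 2.
Proof.
rewrite (@svir_br_coeff _ (inr l)) => [|[m|l'] hl]; rewrite /= mcoeffZ.
- by rewrite mcoeffUU mulr1.
- by rewrite mcoeffU mulr0.
- rewrite mcoeffU; case: eqP => [[e]|]; rewrite ?mulr0 //.
  (* [coset_sum] is a floor; its injectivity is checked in the rationals, where [hs] makes the sum
     exact. *)
  have := congr1 (fun n : int => n%:~R : rat) e.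
  rewrite !coset_sumE // => /addIr/val_inj e'.
  by rewrite e' eqxx in hl.
Qed.

(** Supplies an index at which a structure constant [k - n/2] does not vanish. *)
Lemma exists_coset_neq (q : rat) : exists k, val k != q.
Proof.
have hs0 : s - s \is a Num.int by rewrite subrr rpred0.
pose k0 : coset s := Coset hs0.
have [e|?] := eqVneq (val k0) q; last by exists k0.
exists (coset_add 1 k0); rewrite -e /=.
by rewrite -subr_eq0 addrK oner_eq0.
Qed.

Lemma svir_centralizer_odd x : (forall k, svir_br x (svG K k) = 0) -> x = 0.
Proof.
move=> hx; apply/malgP => -[n|l]; rewrite mcoeff0.
- have [k hk] := exists_coset_neq (n%:~R / 2).
  have /eqP := svir_br_G_coeffG x n k.
  rewrite hx mcoeff0 eq_sym mulf_eq0 fmorph_eq0 subr_eq0 (negPf hk) orbF.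
  by move/eqP.
- have /eqP := svir_br_G_coeffL x l l.
  by rewrite hx mcoeff0 eq_sym mulf_eq0 pnatr_eq0 orbF => /eqP.
Qed.

Context (f : {linear svir K s -> svir K s}).
Context (fC : super_commuting (@svir_br K s) f).

(** Expand the hypothesis at [x + y]. Since it covers inhomogeneous elements, [x] and [y] may have
    different parities. *)
Lemma super_commuting_polarize x y : svir_br (f x) y + svir_br (f y) x = 0.
Proof.
have brDl u v w : svir_br (u + v) w = svir_br u w + svir_br v w.
  by have := svir_br_linearl w 1 u v; rewrite !scale1r.
by have := fC (x + y); rewrite (linearD f) brDl !linearD /= !fC add0r addr0 addrC.
Qed.

Lemma super_commuting_G_coeffG k l : (f (svG K k))@_(inr l : svir_basis s) = 0.
Proof.
have /eqP := svir_br_G_coeffL (f (svG K k)) k l.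
by rewrite fC mcoeff0 eq_sym mulf_eq0 pnatr_eq0 orbF => /eqP.
Qed.

Lemma super_commuting_G_coeffL_neq k (n : int) : n%:~R != val k + val k ->
  (f (svG K k))@_(inl n : svir_basis s) = 0.
Proof.
move=> hn; have /eqP := svir_br_G_coeffG (f (svG K k)) n k.
rewrite fC mcoeff0 eq_sym mulf_eq0 fmorph_eq0 => /orP[/eqP//|].
by rewrite subr_eq0 => /eqP e; case/eqP: hn; rewrite e; field.
Qed.

Lemma super_commuting_G k : f (svG K k) = 0.
Proof.
apply/malgP => -[n|l]; rewrite mcoeff0; last exact: super_commuting_G_coeffG.
have [hn|] := eqVneq (n%:~R : rat) (val k + val k); last first.
  exact: super_commuting_G_coeffL_neq.
(* Now n = 2k. Take l <> k and p = k + l, so that p + k = n + l: both polarized brackets are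
   compared at the same G_(2k+l). *)
have [l hl] := exists_coset_neq (val k).
have [p hp] : exists p : int, p%:~R = val k + val l.
  by exists (coset_sum k l); rewrite coset_sumE.
have e : coset_add p k = coset_add n l.
  by apply: val_inj; rewrite /= hp hn /=; ring.
have E1 := svir_br_G_coeffG (f (svG K k)) n l.
have E2 := svir_br_G_coeffG (f (svG K l)) p k.
rewrite e in E2.
(* Rewriting with E1 would make conversion diverge on the other coefficient. *)
have := congr2 +%R E1 E2; rewrite -mcoeffD super_commuting_polarize mcoeff0.
(* As k + l <> 2l, [f G_l] has no component on L_p; what survives is the coefficient sought times l
   - n/2 = l - k, which is nonzero. *)
rewrite (@super_commuting_G_coeffL_neq l p); last first.
  by rewrite hp (inj_eq (addIr _)) eq_sym.
rewrite mul0r addr0 => /esym/eqP; rewrite mulf_eq0 fmorph_eq0 => /orP[/eqP//|].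
by rewrite hn subr_eq0 => /eqP e2; case/eqP: hl; rewrite e2; field.
Qed.

Lemma super_commuting_eq0 x : f x = 0.
Proof.
have fU (a : svir_basis s) : f << a >> = 0.
  case: a => [m|k]; last exact: super_commuting_G.
  apply: svir_centralizer_odd => k.
  have := super_commuting_polarize (svL K s m) (svG K k).
  by rewrite super_commuting_G /svir_br msupp0 big_seq_fset0 addr0.
rewrite [x]monalgE linear_sum big1 // => a _.
have -> : << x@_a *g a >> = x@_a *: (<< a >> : svir K s).
  by apply/malgP => b; rewrite mcoeffZ !mcoeffU mulrnAr mulr1.
by rewrite linearZ /= fU scaler0.
Qed.

End SuperVirasoroCommuting.

Theorem theorem4p4 (R : realType) (s : rat) (hs : s = 0 \/ s = 2^-1)
    (f : {linear svir R[i] s -> svir R[i] s}) :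
  super_commuting (@svir_br R[i] s) f ->
  exists lambda : R[i], forall x : svir R[i] s, f x = lambda *: x.
Proof.
by move=> fC; exists 0 => x; rewrite scale0r; apply: super_commuting_eq0.
Qed.
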